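(* Let $\mathsf Z$ be a finite set and let $\ell(z,a)\in[0,1]$ for all $(z,a)\in\mathsf Z\times\mathsf A$. Then for any hypothesis space $\mathsf A$, any distribution $P$ on $\mathsf Z$ and any sample size $n\geq 1$, the excess risk $R_{\rm excess}$ of the empirical risk minimization algorithm satisfies $$\mathbb E[R_{\rm excess}]\le\sqrt{\frac{|\mathsf Z|}{n}},$$ and for any $\varepsilon>0$, $$\mathbb P[R_{\rm excess}>\varepsilon]\le\exp\Big\{-n\Big(\frac{\varepsilon^2}2-\frac{|\mathsf Z|\log(n+1)}n\Big)\Big\}.$$
   Context: $\mathsf Z$ is the sample space, $\mathsf A$ the hypothesis space, $\ell:\mathsf Z\times\mathsf A\to\mathbb R$ the loss function. $Z^n=(Z_1,\dots,Z_n)$ is drawn i.i.d. from $P$, with empirical distribution $\widehat P_n$. For a distribution $R$ on $\mathsf Z$, $H_{\mathsf A,\ell}(R)=\inf_{a\in\mathsf A}\mathbb E_R[\ell(Z,a)]$, and this infimum is assumed to be attained for all distributions $R$ on $\mathsf Z$. The empirical risk minimization (ERM) algorithm returns a hypothesis $a_{\widehat P_n}\in\mathsf A$ minimizing $\mathbb E_{\widehat P_n}[\ell(Z,a)]$ over $a\in\mathsf A$. The excess risk is the random variable $R_{\rm excess}=\mathbb E_P[\ell(Z,a_{\widehat P_n})\mid Z^n]-H_{\mathsf A,\ell}(P)$, where $Z\sim P$ is independent of $Z^n$. $\log$ is the natural logarithm. *)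

(* Defs.v *)
From HB Require Import structures.
From mathcomp Require Import all_boot all_order all_algebra.
From mathcomp Require Import all_classical all_reals all_analysis.

Set Implicit Arguments.
Unset Strict Implicit.
Unset Printing Implicit Defensive.

Import Order.TTheory GRing.Theory Num.Theory.
Import numFieldNormedType.Exports.
Local Open Scope classical_set_scope.
Local Open Scope ring_scope.

(* Finite types that also carry a sigma-algebra (and, as every measurableType,
   a base point). The sigma-algebra need not be discrete: discreteness is a
   hypothesis of the statements where it is needed. *)
#[short(type="finMeasurableType")]
HB.structure Definition FinMeasurable d := {T of Finite T & Measurable d T}.

Section RandomVariables.
Context {R : realType} {d : measure_display} {Omega : measurableType d}.
Variable Pr : probability Omega R.

(* Both notions of independence are for finite-valued variables, so the events
   range over all subsets of the codomain (discrete sigma-algebra). *)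
Definition mutually_independent (I T : finType) (X : I -> Omega -> T) : Prop :=
  forall (J : {set I}) (B : I -> set T),
    Pr (\bigcap_(i in [set` J]) (X i @^-1` B i)) =
    (\prod_(i in J) Pr (X i @^-1` B i))%E.

Definition independent (T1 T2 : finType) (X : Omega -> T1) (Y : Omega -> T2) :
    Prop :=
  forall (B : set T1) (C : set T2),
    Pr (X @^-1` B `&` Y @^-1` C) = (Pr (X @^-1` B) * Pr (Y @^-1` C))%E.

(* E[X | Y] for a finite-valued Y: on the event {Y = y} it is the constant
   E[X 1_{Y = y}] / Pr(Y = y), which is 0 (as x / 0 = 0) on null events. *)
Definition cond_expectation (T : finType) (X : Omega -> R) (Y : Omega -> T)
    (w : Omega) : R :=
  let E := [set w' | Y w' = Y w] in
  fine (\int[Pr]_(w' in E) (X w')%:E) / fine (Pr E).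

End RandomVariables.

Section Empirical.
Context {R : realType} {d : measure_display} {Z : finMeasurableType d}.
Context {n : nat}.

(* B |-> #{i < n | z_i \in B} / n; msum takes a sequence of measures, of which
   only the first n are used. The proof of 0 < n is an argument so that the
   probability instance below can be found. *)
Definition empirical (n_gt0 : (0 < n)%N) (z : n.-tuple Z) : set Z -> \bar R :=
  mscale (n%:R^-1)%:nng (msum (fun k => \d_(nth point z k)) n).

Section Instance.
Variables (n_gt0 : (0 < n)%N) (z : n.-tuple Z).

HB.instance Definition _ := Measure.on (empirical n_gt0 z).

Let empirical_setT : empirical n_gt0 z [set: Z] = 1%E.
Proof.
rewrite /empirical /mscale /= /msum.
rewrite (eq_bigr (fun=> 1%:E)); last by move=> i _; exact: diracT.
rewrite sumEFin -EFinM sumr_const card_ord -mulr_natr mul1r mulVf//.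
by rewrite pnatr_eq0 -lt0n.
Qed.

HB.instance Definition _ :=
  @Measure_isProbability.Build _ _ R (empirical n_gt0 z) empirical_setT.

End Instance.

End Empirical.

Section StatisticalLearning.
Context {R : realType} {dZ : measure_display} {Z : finMeasurableType dZ}.
Context {A : Type}.
Variable l : Z -> A -> R.

Definition expected_loss (Q : probability Z R) (a : A) : R :=
  fine 'E_Q[fun z => l z a].

Definition generalized_entropy (Q : probability Z R) : R :=
  inf (range (expected_loss Q)).

(* erm maps the training sample to the returned hypothesis. *)
Definition empirical_risk_minimizer n (n_gt0 : (0 < n)%N)
    (erm : n.-tuple Z -> A) : Prop :=
  forall (z : n.-tuple Z) (a : A),
    expected_loss (empirical n_gt0 z) (erm z) <=
    expected_loss (empirical n_gt0 z) a.

Context {d : measure_display} {Omega : measurableType d}.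
Variable Pr : probability Omega R.

Definition sample n (S : 'I_n -> Omega -> Z) (w : Omega) : n.-tuple Z :=
  [tuple S i w | i < n].

Definition excess_risk (P : probability Z R) n (erm : n.-tuple Z -> A)
    (S : 'I_n -> Omega -> Z) (Z0 : Omega -> Z) (w : Omega) : R :=
  cond_expectation Pr (fun w' => l (Z0 w') (erm (sample S w'))) (sample S) w
  - generalized_entropy P.

End StatisticalLearning.

(* Main.v *)
(* Comparing the ERM hypothesis with an optimal one on both P and the empirical
   distribution bounds the excess risk by the L1 distance of these two
   distributions. The mean of this distance is controlled by the variances p_z / n
   of the frequencies. It exceeds eps only if some subset B of Z has empirical
   mass larger than P(B) + eps / 2, which for each B has probability at most
   exp(- n eps^2 / 2) by Hoeffding's inequality; a union bound over the subsets
   replaces the method of types. *)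
Require Import Defs.
From mathcomp Require Import all_boot all_order all_algebra.
From mathcomp Require Import all_classical all_reals all_analysis.
From mathcomp Require Import ring lra.

Set Implicit Arguments.
Unset Strict Implicit.
Unset Printing Implicit Defensive.

Import Order.TTheory GRing.Theory Num.Theory.
Import numFieldNormedType.Exports.
Local Open Scope classical_set_scope.
Local Open Scope ring_scope.

(** * Hoeffding's bound on the exponential moment of a Bernoulli variable *)

Lemma ge0_of_is_derive_ge0 (R : realType) (f g : R -> R) :
  (forall x : R, is_derive x 1 f (g x)) -> (forall x, 0 <= x -> 0 <= g x) ->
  f 0 = 0 -> forall x, 0 <= x -> 0 <= f x.
Proof.
move=> df g_ge0 f0 x x_ge0; rewrite -f0.
have derf (y : R) : derivable f y 1 by apply: ex_derive.
apply: (@ger0_derive1_ndecry R f 0) => //.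
- move=> y; rewrite in_itv/= andbT => y_gt0.
  by rewrite derive1E (@derive_val _ _ _ _ _ _ _ (df y)) g_ge0 // ltW.
- apply: continuous_subspaceT => y.
  exact/differentiable_continuous/derivable1_diffP.
Qed.

(* The logarithm of the left-hand side has second derivative q (1 - q) <= 1/4,
   where q = p e^x / (1 - p + p e^x) is the exponentially tilted parameter. *)
Lemma bernoulli_mgf_le (R : realType) (p x : R) : 0 <= p <= 1 -> 0 <= x ->
  1 - p + p * expR x <= expR (p * x + x ^+ 2 / 8).
Proof.
move=> /andP[p_ge0 p_le1] x_ge0.
pose m y : R := 1 - p + p * expR y.
have m_gt0 y : 0 < m y.
  rewrite /m; have := expR_gt0 y; have [->|p_neq1] := eqVneq p 1; first by lra.
  have : p < 1 by rewrite lt_neqAle p_neq1.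
  move=> p1 ey; have := mulr_ge0 p_ge0 (ltW ey); lra.
have dm (y : R) : is_derive y 1 m (p * expR y).
  have -> : m = cst (1 - p) + p \*: expR by apply/funext => u.
  by apply: is_derive_eq; rewrite add0r.
have dlnm (y : R) : is_derive y 1 (@ln R \o m) (p * expR y / m y).
  have dln := is_derive1_ln (m_gt0 y).
  apply: is_derive_eq.
  by rewrite mulrC.
have dminv (y : R) : is_derive y 1 (fun u => (m u)^-1) (- (m y) ^- 2 * (p * expR y)).
  by apply: is_derive_eq; [apply: is_deriveV; rewrite gt_eqF|].
(* The gap between the logarithms and its first two derivatives; [h2] uses
   [p * expR y = m y - (1 - p)]. Both [h1] and [h2] vanish at 0, so the sign of [h3] passes to [h2]
   and then to [h1]. *)
pose h1 y := p * y + y ^+ 2 / 8 - ln (m y).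
pose h2 y := p + y / 4 - 1 + (1 - p) / m y.
pose h3 y := 1 / 4 - (1 - p) * (p * expR y) / m y ^+ 2.
have dh1 (y : R) : is_derive y 1 h1 (h2 y).
  have -> : h1 = p \*: id + 8^-1 \*: (id : R -> R) ^+ 2 - (@ln R \o m).
    by apply/funext => u; rewrite /h1/= !fctE/= /GRing.scale/=; ring.
  apply: is_derive_eq; rewrite /GRing.scale/= /h2 expr1.
  have := m_gt0 y => /gt_eqF/negbT; rewrite /m => my; field.
  by rewrite my.
have dh2 (y : R) : is_derive y 1 h2 (h3 y).
  have -> : h2 = cst (p - 1) + 4^-1 \*: id + (1 - p) \*: (fun u => (m u)^-1).
    by apply/funext => u; rewrite /h2/= !fctE/= /GRing.scale/=; ring.
  apply: is_derive_eq; rewrite /GRing.scale/= /h3.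
  have := m_gt0 y => /gt_eqF/negbT; rewrite /m => my; field.
  by rewrite my.
(* With [a = 1 - p] and [b = p * expR y] this is [4 a b <= (a + b)^2]. *)
have h3_ge0 y : 0 <= h3 y.
  rewrite /h3 subr_ge0 ler_pdivrMr ?exprn_gt0// /m.
  have := sqr_ge0 (1 - p - p * expR y); nra.
have m0 : m 0 = 1 by rewrite /m expR0; ring.
have h2_ge0 y : 0 <= y -> 0 <= h2 y.
  apply: (ge0_of_is_derive_ge0 dh2) => //.
  by rewrite /h2 m0; field.
have : 0 <= h1 x.
  apply: (ge0_of_is_derive_ge0 dh1) => //.
  by rewrite /h1 m0 ln1; ring.
rewrite /h1 subr_ge0 -ler_expR lnK //.
by rewrite posrE.
Qed.

(** * Deviation of empirical frequencies under product weights *)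

Lemma sum_tuple_prod (R : comPzRingType) (Z : finType) (n : nat)
    (F : 'I_n -> Z -> R) :
  \sum_(t : n.-tuple Z) \prod_(i < n) F i (tnth t i)
  = \prod_(i < n) \sum_z F i z.
Proof.
rewrite bigA_distr_bigA /=.
rewrite (reindex (fun f : {ffun 'I_n -> Z} => [tuple f i | i < n])) /=.
  by apply: eq_bigr => f _; apply: eq_bigr => i _; rewrite tnth_mktuple.
exists (fun t : n.-tuple Z => [ffun i => tnth t i]) => [f _|t _].
  by apply/ffunP => i; rewrite ffunE tnth_mktuple.
by apply: eq_from_tnth => i; rewrite tnth_mktuple ffunE.
Qed.

Section IidSample.
Context {R : realType} {Z : finType} {n : nat}.
Variable p : Z -> R.
Hypotheses (p_ge0 : forall z, 0 <= p z) (sum_p : \sum_z p z = 1).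

(** Expectations and probabilities in this section are finite sums with this weight; [sample_law]
    links them to [Pr]. *)
Definition iid_weight (t : n.-tuple Z) : R := \prod_(i < n) p (tnth t i).

Definition frequency (t : n.-tuple Z) (z : Z) : R :=
  n%:R^-1 * \sum_(i < n) (tnth t i == z)%:R.

Definition l1_deviation (t : n.-tuple Z) : R :=
  \sum_z `|frequency t z - p z|.

Lemma iid_weight_ge0 t : 0 <= iid_weight t.
Proof. exact: prodr_ge0. Qed.

Lemma l1_deviation_ge0 t : 0 <= l1_deviation t.
Proof. exact: sumr_ge0. Qed.

Lemma sum_iid_weight : \sum_t iid_weight t = 1.
Proof.
by rewrite (sum_tuple_prod (fun=> p)) big1.
Qed.

(** Independence of the coordinates in finite form; the variance computation and the Chernoff bound
    both rest on it. *)
Lemma mean_prod (h : 'I_n -> Z -> R) :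
  \sum_t iid_weight t * \prod_(i < n) h i (tnth t i)
  = \prod_(i < n) \sum_z p z * h i z.
Proof.
rewrite -(sum_tuple_prod (fun i z => p z * h i z)).
by apply: eq_bigr => t _; rewrite -big_split.
Qed.

(** In the expanded square, independence gives every off-diagonal term a factor of mean 0, so only
    the [n] diagonal terms remain. *)
Lemma mean_centered_sum_sq (h : Z -> R) : \sum_z p z * h z = 0 ->
  \sum_t iid_weight t * (\sum_(i < n) h (tnth t i)) ^+ 2
  = n%:R * \sum_z p z * h z ^+ 2.
Proof.
move=> h0; under eq_bigr do rewrite expr2 mulr_suml mulr_sumr.
rewrite exchange_big /=.
transitivity (\sum_(i < n) \sum_z p z * h z ^+ 2); last first.
  by rewrite sumr_const card_ord mulr_natl.
apply: eq_bigr => i _.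
under eq_bigr do rewrite mulr_sumr mulr_sumr.
rewrite exchange_big /= (bigD1 i)//= [X in _ + X]big1 ?addr0.
  (* Padding with factors 1 at the other indices yields a full product, to which [mean_prod]
     applies. *)
  pose u (m : 'I_n) z : R := if m == i then h z ^+ 2 else 1.
  transitivity (\sum_t iid_weight t * \prod_(m < n) u m (tnth t m)).
    apply: eq_bigr => t _; rewrite (bigD1 i)//= big1 ?mulr1 /u ?eqxx ?expr2//.
    by move=> m /negbTE ->.
  rewrite mean_prod (bigD1 i)//= [X in _ * X]big1 ?mulr1 /u ?eqxx//
    => m /negbTE ->.
  by under eq_bigr do rewrite mulr1.
move=> j ji.
pose u (m : 'I_n) z : R := if (m == i) || (m == j) then h z else 1.
transitivity (\sum_t iid_weight t * \prod_(m < n) u m (tnth t m)).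
  apply: eq_bigr => t _; rewrite (bigD1 i)//= (bigD1 j)//= big1 ?mulr1 /u.
    by rewrite !eqxx orbT.
  by move=> m /andP[/negbTE -> /negbTE ->].
rewrite mean_prod (bigD1 i)//= /u eqxx /=.
by under eq_bigr do rewrite -/(h _); rewrite h0 mul0r.
Qed.

Hypothesis n_gt0 : (0 < n)%N.

Let nR_gt0 : 0 < n%:R :> R. Proof. by rewrite ltr0n. Qed.

Lemma frequencyB (t : n.-tuple Z) (z : Z) :
  frequency t z - p z = n%:R^-1 * \sum_(i < n) ((tnth t i == z)%:R - p z).
Proof.
rewrite /frequency sumrB mulrBr; congr (_ - _).
by rewrite sumr_const card_ord -[p z *+ n]mulr_natl mulKf// gt_eqF.
Qed.

(** The variance is exactly [(p z - p z ^+ 2) / n]; dropping the square leaves a bound that sums to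
    [1 / n] over [z]. *)
Lemma mean_frequency_sq (z : Z) :
  \sum_t iid_weight t * (frequency t z - p z) ^+ 2 <= p z / n%:R.
Proof.
pose h x : R := (x == z)%:R - p z.
have pz : \sum_x p x * (x == z)%:R = p z.
  rewrite (bigD1 z)//= eqxx mulr1 big1 ?addr0// => x /negbTE ->.
  by rewrite mulr0.
have h0 : \sum_x p x * h x = 0.
  under eq_bigr do rewrite mulrBr.
  by rewrite sumrB pz -mulr_suml sum_p mul1r subrr.
have -> : \sum_t iid_weight t * (frequency t z - p z) ^+ 2
    = n%:R^-1 ^+ 2 * \sum_t iid_weight t * (\sum_(i < n) h (tnth t i)) ^+ 2.
  rewrite mulr_sumr; apply: eq_bigr => t _.
  by rewrite frequencyB /h exprMn mulrCA.
rewrite mean_centered_sum_sq//.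
have -> : \sum_x p x * h x ^+ 2 = p z - p z ^+ 2.
  (* An indicator equals its square, so [h x ^+ 2] is affine in it. *)
  transitivity (\sum_x ((1 - 2 * p z) * (p x * (x == z)%:R)
                        + p z ^+ 2 * p x)).
    by apply: eq_bigr => x _; rewrite /h; case: (x == z) => /=; ring.
  by rewrite big_split/= -!mulr_sumr pz sum_p; ring.
rewrite expr2 -mulrA mulKf ?gt_eqF// mulrC ler_pM2r ?invr_gt0//.
by rewrite gerBl sqr_ge0.
Qed.

Lemma mean_l1_deviation_le :
  \sum_t iid_weight t * l1_deviation t <= Num.sqrt (#|Z|%:R / n%:R).
Proof.
(* [Z] is nonempty because [p] has total mass 1; hence [s] and [c] are positive and [c] can be
   inverted. *)
have Z_gt0 : 0 < #|Z|%:R :> R.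
  rewrite ltr0n lt0n; apply/negP => /eqP/card0_eq Z0.
  by move: sum_p; rewrite big_pred0 // => /esym/eqP; rewrite oner_eq0.
set s := Num.sqrt _.
have s_gt0 : 0 < s by rewrite sqrtr_gt0 divr_gt0.
have s2 : s ^+ 2 = #|Z|%:R / n%:R by rewrite sqr_sqrtr// divr_ge0// ltW.
pose c : R := n%:R * s.
have c_gt0 : 0 < c by rewrite mulr_gt0.
(* AM-GM, with the weight [c] that makes both halves of the bound equal. *)
have amgm (x : R) : `|x| <= (c * x ^+ 2 + c^-1) / 2.
  rewrite -(ler_pM2l c_gt0) -real_normK ?num_real//.
  have -> : c * ((c * `|x| ^+ 2 + c^-1) / 2) = ((c * `|x|) ^+ 2 + 1) / 2.
    by field; rewrite gt_eqF.
  have := sqr_ge0 (c * `|x| - 1); lra.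
apply: (@le_trans _ _ (\sum_t iid_weight t *
    \sum_z (c * (frequency t z - p z) ^+ 2 + c^-1) / 2)).
  by apply: ler_sum => t _; rewrite ler_wpM2l ?iid_weight_ge0 ?ler_sum.
have -> : \sum_t iid_weight t *
    \sum_z (c * (frequency t z - p z) ^+ 2 + c^-1) / 2
  = c / 2 * \sum_z \sum_t iid_weight t * (frequency t z - p z) ^+ 2
    + c^-1 / 2 * #|Z|%:R.
  have -> : c^-1 / 2 * #|Z|%:R
      = \sum_t c^-1 / 2 * #|Z|%:R * iid_weight t.
    by rewrite -mulr_sumr sum_iid_weight mulr1.
  rewrite exchange_big /= mulr_sumr -big_split /=; apply: eq_bigr => t _.
  rewrite -mulr_suml big_split/= sumr_const -!mulr_sumr.
  rewrite -[c^-1 *+ _]mulr_natl.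
  by ring.
apply: (@le_trans _ _ (c / 2 * \sum_z p z / n%:R + c^-1 / 2 * #|Z|%:R)).
  rewrite lerD2r ler_wpM2l ?divr_ge0 ?(ltW c_gt0)//.
  by apply: ler_sum => z _; exact: mean_frequency_sq.
rewrite -mulr_suml sum_p.
(* Both halves equal [s / 2]: the first is [c / (2 n)], the second [n s^2 / (2 c)]. *)
have -> : #|Z|%:R = n%:R * s ^+ 2 by rewrite s2 mulrC divfK// gt_eqF.
rewrite le_eqVlt; apply/orP; left; apply/eqP.
by rewrite /c; field; rewrite !gt_eqF.
Qed.

(** [n] times the excess mass of [B] is a sum of [n] independent centred Bernoulli variables of
    parameter [P], so the mean is the [n]-th power of one exponential moment. *)
Lemma chernoff_subset (B : {set Z}) (x : R) : 0 <= x ->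
  \sum_t iid_weight t * expR (x * (n%:R * \sum_(z in B) (frequency t z - p z)))
  <= expR (n%:R * (x ^+ 2 / 8)).
Proof.
move=> x_ge0; pose P := \sum_(z in B) p z.
have P01 : 0 <= P <= 1.
  rewrite /P sumr_ge0//= -sum_p [leRHS](bigID (mem B))/= lerDl.
  exact: sumr_ge0.
pose h z := expR (x * ((z \in B)%:R - P)).
have freqB t : n%:R * \sum_(z in B) (frequency t z - p z)
    = \sum_(i < n) ((tnth t i \in B)%:R - P).
  under eq_bigr do rewrite frequencyB.
  rewrite -mulr_sumr mulVKf ?gt_eqF// exchange_big; apply: eq_bigr => i _.
  rewrite sumrB -/P; congr (_ - _).
  have [iB|iB] := boolP (tnth t i \in B).
    rewrite (bigD1 (tnth t i))//= eqxx big1 ?addr0// => z /andP[_].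
    by rewrite eq_sym => /negbTE ->.
  rewrite big1// => z zB; case: eqP => // tz.
  by rewrite tz zB in iB.
have -> : \sum_t iid_weight t
      * expR (x * (n%:R * \sum_(z in B) (frequency t z - p z)))
    = \sum_t iid_weight t * \prod_(i < n) h (tnth t i).
  by apply: eq_bigr => t _; rewrite freqB mulr_sumr expR_sum.
rewrite (mean_prod (fun=> h)) prodr_const card_ord expRM_natl.
apply: lerXn2r; rewrite ?nnegrE ?expR_ge0//.
  by apply: sumr_ge0 => z _; rewrite mulr_ge0 ?expR_ge0.
have -> : \sum_z p z * h z = (1 - P + P * expR x) * expR (- (P * x)).
  have -> : 1 - P = \sum_(z | z \notin B) p z.
    by rewrite -sum_p (bigID (mem B))/= addrAC subrr add0r.
  set e := expR (- _).
  rewrite (bigID (mem B))/= addrC mulrDl mulr_suml {1}/P !mulr_suml.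
  congr (_ + _); apply: eq_bigr => z zB; rewrite /h /e.
    by rewrite (negbTE zB) sub0r mulrN [x * P]mulrC.
  by rewrite zB -mulrA -expRD mulrBr mulr1 [x * P]mulrC.
(* Moving the centring factor to the right produces the linear term in [bernoulli_mgf_le]. *)
rewrite expRN ler_pdivrMr ?expR_gt0// -expRD [_ + P * x]addrC.
exact: bernoulli_mgf_le.
Qed.

Lemma l1_deviation_tail_le (eps : R) : 0 < eps ->
  \sum_(t | eps < l1_deviation t) iid_weight t
  <= expR (- n%:R * (eps ^+ 2 / 2 - #|Z|%:R * ln (n%:R + 1) / n%:R)).
Proof.
move=> eps_gt0.
pose dev (B : {set Z}) t := \sum_(z in B) (frequency t z - p z).
(* The positive and negative parts of the signed measure [frequency t - p]
   have the same mass, so each carries half of the L1 deviation. *)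
have half t : l1_deviation t / 2 = dev [set z | p z < frequency t z]%SET t.
  have sum_freq : \sum_z frequency t z = 1.
    rewrite -mulr_sumr exchange_big/= (eq_bigr (fun=> 1)) => [|i _].
      by rewrite sumr_const card_ord mulVf ?gt_eqF.
    by rewrite (bigD1 (tnth t i))//= eqxx big1 ?addr0// => z /negbTE;
      rewrite eq_sym => ->.
  have sum0 : \sum_z (frequency t z - p z) = 0.
    by rewrite sumrB sum_freq sum_p subrr.
  rewrite /dev big_mkcond/=; apply: (@mulIf _ 2); rewrite ?pnatr_eq0//.
  rewrite divfK ?pnatr_eq0// mulr_suml.
  (* For real [d], [|d| + d] is [2 d] if [d > 0] and 0 otherwise. *)
  transitivity (l1_deviation t + \sum_z (frequency t z - p z)).
    by rewrite sum0 addr0.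
  rewrite -big_split/=.
  apply: eq_bigr => z _; rewrite inE; case: ltP => pf.
    by rewrite gtr0_norm ?subr_gt0//; ring.
  by rewrite ler0_norm ?subr_le0//; ring.
(* The excess mass has to pass [eps / 2], and [2 * eps] minimizes the exponent
   [x ^+ 2 / 8 - x * eps / 2], with value [- eps ^+ 2 / 2]. *)
pose x : R := 2 * eps.
(* Markov's inequality and the union bound at once: the term of the set from [half] is already at
   least 1, so the sum dominates the indicator of the event. *)
have markov t : eps < l1_deviation t ->
    1 <= \sum_(B : {set Z}) expR (x * (n%:R * dev B t) - n%:R * eps ^+ 2).
  move=> lt_eps; rewrite (bigD1 [set z | p z < frequency t z]%SET)//=.
  rewrite -half; apply: ler_wpDr; first by apply: sumr_ge0 => *; exact: expR_ge0.
  rewrite -[leLHS]expR0 ler_expR subr_ge0 /x.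
  have -> : 2 * eps * (n%:R * (l1_deviation t / 2))
    = n%:R * (eps * l1_deviation t) by field.
  by rewrite ler_pM2l// expr2 ler_pM2l// ltW.
apply: (@le_trans _ _ (\sum_t iid_weight t *
    \sum_(B : {set Z}) expR (x * (n%:R * dev B t) - n%:R * eps ^+ 2))).
  rewrite big_mkcond; apply: ler_sum => t _; case: ifPn => [lt_eps|_].
    by rewrite ler_peMr ?iid_weight_ge0 ?markov.
  by rewrite mulr_ge0 ?iid_weight_ge0// sumr_ge0// => *; exact: expR_ge0.
apply: (@le_trans _ _ (\sum_(B : {set Z}) expR (- (n%:R * (eps ^+ 2 / 2))))).
  under eq_bigr do rewrite mulr_sumr.
  rewrite exchange_big; apply: ler_sum => B _.
  under eq_bigr do rewrite expRD mulrA.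
  rewrite -mulr_suml expRN ler_pdivrMr ?expR_gt0// -expRD.
  apply: (le_trans (chernoff_subset B _)); first by rewrite /x mulr_ge0// ltW.
  by rewrite ler_expR /x le_eqVlt; apply/orP; left; apply/eqP; field.
have card_subsets : #|{: {set Z}}| = (2 ^ #|Z|)%N.
  by rewrite -[LHS]cardsT -powersetT card_powerset cardsT.
rewrite sumr_const card_subsets -[_ *+ _]mulr_natl.
have -> : - n%:R * (eps ^+ 2 / 2 - #|Z|%:R * ln (n%:R + 1) / n%:R)
   = #|Z|%:R * ln (n%:R + 1) - n%:R * (eps ^+ 2 / 2) :> R.
  by field; rewrite gt_eqF.
rewrite expRD ler_wpM2r ?expR_ge0// expRM_natl lnK; last first.
  by rewrite posrE ltr_wpDl.
(* The union bound costs 2 ^ #|Z|, which is at most (n + 1) ^ #|Z|. *)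
by rewrite natrX lerXn2r ?nnegrE// -natr1 lerD2r ler1n.
Qed.

End IidSample.

(** * Integrals of finite-valued variables as finite sums *)

Section Transfer.
Context {d} {Omega : measurableType d} {R : realType}.
Variable Pr : probability Omega R.
Context {T : finType}.
Variable Y : Omega -> T.
Hypothesis mY : forall t, measurable (Y @^-1` [set t]).

(** Measurability of the fibres of [Y] suffices, since [f (Y w)] is a finite linear combination of
    their indicators. *)
Lemma integral_finite_valued (D : set Omega) (f : T -> R) : measurable D ->
  (\int[Pr]_(w in D) (f (Y w))%:E)%E
  = (\sum_t f t * fine (Pr (Y @^-1` [set t] `&` D)))%:E.
Proof.
move=> mD.
pose g t w : \bar R := ((f t)%:E * (\1_(Y @^-1` [set t]) w)%:E)%E.
have int1 t : Pr.-integrable D (fun w => (\1_(Y @^-1` [set t]) w)%:E).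
  exact: integrableS (integrable_indic _ _).
have -> : (\int[Pr]_(w in D) (f (Y w))%:E = \int[Pr]_(w in D) (\sum_t g t w))%E.
  apply: eq_integral => w _; rewrite (bigD1 (Y w))//= big1 ?adde0 /g.
    by rewrite indicE mem_set// mule1.
  move=> t tY; rewrite indicE memNset ?mule0//.
  by move=> /= Yt; rewrite Yt eqxx in tY.
rewrite integral_sum//; last by move=> t; exact: integrableZl.
rewrite -sumEFin; apply: eq_bigr => t _.
rewrite integralZl// integral_indic// EFinM fineK// fin_num_measure//.
exact: measurableI.
Qed.

Lemma fine_probability_preimage (B : set T) :
  Pr (Y @^-1` B) = (\sum_(t | t \in B) fine (Pr (Y @^-1` [set t])))%:E.
Proof.
have mB : measurable (Y @^-1` B).
  have -> : Y @^-1` B = \bigcup_(t in B) Y @^-1` [set t].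
    by apply/seteqP; split => [w Bw|w [t Bt /= Yt]]; [exists (Y w)|rewrite Yt].
  exact: fin_bigcup_measurable.
rewrite -[Y @^-1` B]setIT -integral_indic// (eq_integral (fun w => (\1_B (Y w))%:E))//.
rewrite integral_finite_valued// [in RHS]big_mkcond/=; congr EFin.
apply: eq_bigr => t _; rewrite setIT indicE.
by case: (t \in B); rewrite ?mul1r ?mul0r.
Qed.

End Transfer.

(** * Excess risk bounded by the L1 deviation *)

Section Learning.
Context {R : realType} {dZ : measure_display} {Z : finMeasurableType dZ}.
Hypothesis mZ : forall B : set Z, measurable B.

Lemma expected_loss_sum (A : Type) (l : Z -> A -> R) (Q : probability Z R) a :
  expected_loss l Q a = \sum_z fine (Q [set z]) * l z a.
Proof.
rewrite /expected_loss expectation.unlock.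
rewrite (@integral_finite_valued _ _ _ Q Z id _ _ (l ^~ a))//=.
by apply: eq_bigr => z _; rewrite setIT mulrC.
Qed.

Lemma sum_probability_set1 (Q : probability Z R) :
  \sum_z fine (Q [set z]) = 1.
Proof.
apply: EFin_inj; rewrite -(probability_setT Q).
rewrite (@fine_probability_preimage _ _ _ Q Z id _ setT)//.
by congr EFin; apply: eq_bigl => z; rewrite in_setT.
Qed.

Lemma empirical_set1 n (n_gt0 : (0 < n)%N) (t : n.-tuple Z) (z : Z) :
  fine (empirical n_gt0 t [set z] : \bar R) = frequency t z.
Proof.
rewrite /empirical /mscale/= /msum /frequency.
rewrite (eq_bigr (fun i : 'I_n => (nth point t i \in [set z])%:R%:E)); last first.
  by move=> i _; exact: diracE.
rewrite sumEFin/=; congr (_ * _); apply: eq_bigr => i _.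
rewrite (tnth_nth point); congr (_%:R); congr nat_of_bool.
by apply/idP/eqP => [|<-]; rewrite inE.
Qed.

Context {A : Type}.
Variable l : Z -> A -> R.
Hypothesis l01 : forall z a, 0 <= l z a <= 1.

(** Adding the nonnegative gap under [Q] gives the sum of [(Q - P) (l b - l a)], where the loss
    difference is at most 1 in absolute value. Bounding each hypothesis separately by the L1
    distance would cost a factor 2. *)
Lemma expected_loss_diff_le (P Q : probability Z R) a b :
  expected_loss l Q a <= expected_loss l Q b ->
  expected_loss l P a - expected_loss l P b
  <= \sum_z `|fine (Q [set z]) - fine (P [set z])|.
Proof.
rewrite -subr_ge0 !expected_loss_sum => Qab.
rewrite -[leLHS]addr0; apply: le_trans (lerD (lexx _) Qab) _.
rewrite -!sumrB -big_split/=; apply: ler_sum => z _.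
apply: le_trans (ler_norm _) _.
rewrite (_ : _ + _ = (fine (Q [set z]) - fine (P [set z])) * (l z b - l z a)).
  rewrite normrM ler_piMr// ler_norml.
  by have := l01 z a; have := l01 z b; lra.
by ring.
Qed.

Context {d : measure_display} {Omega : measurableType d}.
Variables (Pr : probability Omega R) (P : probability Z R).
Variables (n : nat) (n_gt0 : (0 < n)%N) (erm : n.-tuple Z -> A).
Variables (S : 'I_n -> {RV Pr >-> Z}) (Z0 : {RV Pr >-> Z}).
Hypothesis entropy_attained :
  exists a, expected_loss l P a = generalized_entropy l P.
Hypothesis ermP : empirical_risk_minimizer l n_gt0 erm.
Hypothesis indepS : mutually_independent Pr S.
Hypothesis distrS : forall i B, distribution Pr (S i) B = P B.
Hypothesis distrZ0 : forall B, distribution Pr Z0 B = P B.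
Hypothesis indepZ0 : independent Pr Z0 (sample S).

Let p z := fine (P [set z]).

Lemma sample_preimage t :
  sample S @^-1` [set t] = \bigcap_(i in [set` [set: 'I_n]%SET])
    (S i @^-1` [set tnth t i]).
Proof.
apply/seteqP; split => [w/= <- i _/=|w Sw]; first by rewrite tnth_mktuple.
apply: eq_from_tnth => i; rewrite tnth_mktuple.
by have := Sw i; apply; rewrite /= inE.
Qed.

Lemma measurable_RV_preimage (X : {RV Pr >-> Z}) B : measurable (X @^-1` B).
Proof. by rewrite -[_ @^-1` _]setTI; exact: measurable_funP. Qed.

Lemma measurable_sample_preimage t : measurable (sample S @^-1` [set t]).
Proof.
rewrite sample_preimage; apply: fin_bigcap_measurable => // i _.
exact: measurable_RV_preimage.
Qed.

Lemma sample_law t : Pr (sample S @^-1` [set t]) = (iid_weight p t)%:E.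
Proof.
rewrite sample_preimage indepS /iid_weight -prodEFin.
apply: eq_big => [i|i _]; first by rewrite inE.
by rewrite /p fineK ?fin_num_measure// -(distrS i).
Qed.

(* [excess_risk] as a function of the value [t] of the sample. It is
   [- generalized_entropy l P] when [t] has probability 0, since x / 0 = 0. *)
Definition sample_excess_risk (t : n.-tuple Z) : R :=
  let E := sample S @^-1` [set t] in
  fine (\int[Pr]_(w in E) (l (Z0 w) (erm (sample S w)))%:E) / fine (Pr E)
  - generalized_entropy l P.

Lemma sample_excess_risk_le t : sample_excess_risk t <= l1_deviation p t.
Proof.
rewrite /sample_excess_risk; set E := _ @^-1` _; cbv zeta.
have EE : E = sample S @^-1` [set t] by [].
have mE : measurable E by exact: measurable_sample_preimage.
(* On [E] the returned hypothesis is the constant [erm t], and independence of [Z0] from the sample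
   splits off the factor [Pr E]. *)
have -> : (\int[Pr]_(w' in E) (l (Z0 w') (erm (sample S w')))%:E
    = (expected_loss l P (erm t) * fine (Pr E))%:E)%E.
  transitivity (\int[Pr]_(w' in E) (l (Z0 w') (erm t))%:E)%E.
    by apply: eq_integral => w'; rewrite inE /E /= => ->.
  rewrite (@integral_finite_valued _ _ _ Pr Z Z0 _ _ (l ^~ (erm t)))//; last first.
    by move=> z; exact: measurable_RV_preimage.
  rewrite expected_loss_sum mulr_suml; congr EFin; apply: eq_bigr => z _.
  rewrite EE indepZ0 fineM ?fin_num_measure//; last exact: measurable_RV_preimage.
  by rewrite mulrA -(distrZ0 [set z]) [l _ _ * _]mulrC.
have [a aP] := entropy_attained.
(* On a null event the quotient is 0 by default, and the entropy is nonnegative because the losses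
   are. *)
rewrite /=; have [->|E_neq0] := eqVneq (fine (Pr E)) 0.
  rewrite mulr0 mul0r sub0r -aP (@le_trans _ _ 0) ?l1_deviation_ge0//.
  rewrite oppr_le0 expected_loss_sum sumr_ge0// => z _.
  by rewrite mulr_ge0 ?fine_ge0//; case/andP: (l01 z a).
rewrite mulfK// -aP.
apply: (le_trans (expected_loss_diff_le P (ermP t a))).
by apply: ler_sum => z _; rewrite empirical_set1.
Qed.

Lemma expectation_excess_risk_le :
  ('E_Pr[excess_risk l Pr P erm S Z0]
    <= (\sum_(t : n.-tuple Z) iid_weight p t * l1_deviation p t)%:E)%E.
Proof.
rewrite expectation.unlock.
(* By conversion, [excess_risk] is [sample_excess_risk] composed with the sample. *)
rewrite (@integral_finite_valued _ _ _ Pr _ (sample S) _ _ sample_excess_risk)//.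
  rewrite lee_fin; apply: ler_sum => t _.
  rewrite setIT sample_law/= mulrC ler_wpM2l ?sample_excess_risk_le//.
  by apply: prodr_ge0 => i _; rewrite /p fine_ge0.
exact: measurable_sample_preimage.
Qed.

Lemma excess_risk_tail_le (eps : R) :
  (Pr [set w | (eps < excess_risk l Pr P erm S Z0 w)%R]
    <= (\sum_(t : n.-tuple Z | eps < l1_deviation p t) iid_weight p t)%:E)%E.
Proof.
have -> : [set w | eps < excess_risk l Pr P erm S Z0 w]
    = sample S @^-1` [set t | eps < sample_excess_risk t] by [].
rewrite fine_probability_preimage; last exact: measurable_sample_preimage.
rewrite lee_fin big_mkcond [leRHS]big_mkcond; apply: ler_sum => t _ /=.
rewrite sample_law/=.
have w_ge0 : 0 <= iid_weight p t by apply: prodr_ge0 => i _; rewrite /p fine_ge0.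
case: ifPn => [/set_mem/= lt_eps|_]; last by case: ifP.
by rewrite (lt_le_trans lt_eps (sample_excess_risk_le t)).
Qed.

End Learning.

Theorem theorem13 (R : realType)
    (dZ : measure_display) (Z : finMeasurableType dZ) (A : Type)
    (l : Z -> A -> R) (P : probability Z R) (n : nat) (n_gt0 : (0 < n)%N)
    (erm : n.-tuple Z -> A)
    (d : measure_display) (Omega : measurableType d) (Pr : probability Omega R)
    (S : 'I_n -> {RV Pr >-> Z}) (Z0 : {RV Pr >-> Z}) :
  (forall B : set Z, measurable B) ->
  (forall z a, 0 <= l z a <= 1) ->
  (forall Q : probability Z R,
     exists a, expected_loss l Q a = generalized_entropy l Q) ->
  empirical_risk_minimizer l n_gt0 erm ->
  mutually_independent Pr S ->
  (forall i B, distribution Pr (S i) B = P B) ->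
  (forall B, distribution Pr Z0 B = P B) ->
  independent Pr Z0 (sample S) ->
  ('E_Pr[excess_risk l Pr P erm S Z0]
     <= (Num.sqrt (#|Z|%:R / n%:R))%:E)%E /\
  (forall eps : R, 0 < eps ->
    (Pr [set w | (eps < excess_risk l Pr P erm S Z0 w)%R]
       <= (expR (- n%:R * (eps ^+ 2 / 2
                            - #|Z|%:R * ln (n%:R + 1) / n%:R)))%:E)%E).
Proof.
move=> mZ l01 attained ermP indepS distrS distrZ0 indepZ0.
pose p z := fine (P [set z]).
have p_ge0 z : 0 <= p z by exact: fine_ge0.
have sum_p : \sum_z p z = 1 by exact: sum_probability_set1.
split.
  apply: (le_trans (expectation_excess_risk_le mZ l01 (attained P) ermP
                      indepS distrS distrZ0 indepZ0)).
  by rewrite lee_fin mean_l1_deviation_le.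
move=> eps eps_gt0.
apply: (le_trans (excess_risk_tail_le mZ l01 (attained P) ermP
                    indepS distrS distrZ0 indepZ0 eps)).
by rewrite lee_fin l1_deviation_tail_le.
Qed.
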